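(* Let $(\mathcal S,\gamma)$ be an IFS arc with similarity dimension $s$. Then $\gamma$ is a quasiarc if and only if the Hutchinson parameterization $\phi:[0,1]\to\gamma$ is $\frac1s$-bi-Hölder continuous, i.e. there is $K\ge1$ with $K^{-1}|u-v|^{1/s}\le |\phi(u)-\phi(v)|\le K|u-v|^{1/s}$ for all $u,v\in[0,1]$.
   Context: Let $\mathcal S=\{S_1,\dots,S_N\}$, $N\ge2$, be contracting similarities of $\mathbb{R}^n$ with ratios $r_i\in(0,1)$, and $\gamma$ its invariant set (unique nonempty compact set with $\gamma=\bigcup_i S_i(\gamma)$). $(\mathcal S,\gamma)$ is an IFS path if there are $a,b\in\mathbb{R}^n$ with $S_1(a)=a$, $S_N(b)=b$, $S_i(b)=S_{i+1}(a)$ for $i=1,\dots,N-1$. It is an IFS arc if moreover $S_i(\gamma)\cap S_{i+1}(\gamma)=\{S_{i+1}(a)\}$ for $i=1,\dots,N-1$ and $S_i(\gamma)\cap S_j(\gamma)=\emptyset$ for $i,j\in\{1,\dots,N\}$, $|i-j|>1$. The similarity dimension is the unique $s>0$ with $\sum_i r_i^s=1$. Hutchinson parameterization: set $t_0=0$ and $t_i=t_{i-1}+r_i^s$ (so $t_N=1$), $s_i(t)=t\,t_i+(1-t)t_{i-1}$; for a finite word $\sigma=(\sigma_1,\dots,\sigma_k)$ write $S_\sigma=S_{\sigma_1}\circ\cdots\circ S_{\sigma_k}$, $s_\sigma$ likewise. Let $\phi_0(t)=a+t(b-a)$ and $\phi_k(t)=S_\sigma\circ\phi_0\circ s_\sigma^{-1}(t)$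 for $t\in s_\sigma([0,1])$, $\sigma\in\{1,\dots,N\}^k$. The maps $\phi_k$ converge uniformly to a continuous surjection $\phi:[0,1]\to\gamma$, the Hutchinson parameterization. A quasiarc is a metric space quasisymmetrically equivalent to $[0,1]$ ($\gamma$ with the Euclidean metric). *)

(* Defs.v *)
From HB Require Import structures.
From mathcomp Require Import all_boot all_order all_algebra.
From mathcomp Require Import all_classical all_reals all_analysis.
Set Implicit Arguments. Unset Strict Implicit. Unset Printing Implicit Defensive.
Import Order.TTheory GRing.Theory Num.Theory.
Import numFieldNormedType.Exports.
Local Open Scope classical_set_scope.
Local Open Scope ring_scope.

Section Defs.
Variables (R : realType) (n : nat).
Notation pt := 'rV[R]_n.

Definition eucl_dist (x y : pt) : R := Num.sqrt (\sum_(i < n) (x 0 i - y 0 i) ^+ 2).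

Definition similarity (r : R) (f : pt -> pt) : Prop :=
  forall x y, eucl_dist (f x) (f y) = r * eucl_dist x y.

Definition contracting_IFS (N : nat) (S : nat -> pt -> pt) (r : nat -> R) : Prop :=
  (2 <= N)%N /\ forall i, (i < N)%N -> 0 < r i < 1 /\ similarity (r i) (S i).

Definition invariant_set (N : nat) (S : nat -> pt -> pt) (gamma : set pt) : Prop :=
  gamma !=set0 /\ compact gamma /\
  gamma = \bigcup_(i in [set i | (i < N)%N]) (S i @` gamma).

Definition IFS_path (N : nat) (S : nat -> pt -> pt) (a b : pt) : Prop :=
  S 0%N a = a /\ S N.-1 b = b /\
  forall i, (i.+1 < N)%N -> S i b = S i.+1 a.

Definition IFS_arc (N : nat) (S : nat -> pt -> pt) (gamma : set pt) (a b : pt) : Prop :=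
  IFS_path N S a b /\
  (forall i, (i.+1 < N)%N -> S i @` gamma `&` S i.+1 @` gamma = [set S i.+1 a]) /\
  (forall i j, (i < N)%N -> (j < N)%N -> (i.+1 < j)%N ->
      S i @` gamma `&` S j @` gamma = set0).

Definition similarity_dimension (N : nat) (r : nat -> R) (s : R) : Prop :=
  0 < s /\ \sum_(i < N) r i `^ s = 1.

Definition tpt (r : nat -> R) (s : R) (i : nat) : R := \sum_(j < i) r j `^ s.
Definition spar (r : nat -> R) (s : R) (i : nat) (t : R) : R :=
  t * tpt r s i.+1 + (1 - t) * tpt r s i.

Definition Sword (S : nat -> pt -> pt) (sigma : seq nat) (x : pt) : pt :=
  foldr (fun i y => S i y) x sigma.
Definition sword (r : nat -> R) (s : R) (sigma : seq nat) (t : R) : R :=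
  foldr (fun i u => spar r s i u) t sigma.

Definition phi0 (a b : pt) (t : R) : pt := a + t *: (b - a).

(** phi_k takes the value x at t iff t = s_sigma(u), x = S_sigma(phi_0 u)
    for some word sigma of length k and u in [0,1]
    (i.e. phi_k(t) = S_sigma o phi_0 o s_sigma^{-1}(t) on s_sigma([0,1])). *)
Definition phik (N : nat) (S : nat -> pt -> pt) (r : nat -> R) (s : R)
    (a b : pt) (k : nat) (t : R) (x : pt) : Prop :=
  exists sigma : seq nat, exists u : R,
    size sigma = k /\ all (fun i => (i < N)%N) sigma /\ 0 <= u <= 1 /\
    t = sword r s sigma u /\ x = Sword S sigma (phi0 a b u).

Definition hutchinson_param (N : nat) (S : nat -> pt -> pt) (r : nat -> R) (s : R)
    (a b : pt) (phi : R -> pt) : Prop :=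
  forall eps : R, 0 < eps -> exists K : nat, forall k : nat, (K <= k)%N ->
    forall t x, phik N S r s a b k t x -> eucl_dist (phi t) x <= eps.

Definition homeo_nonneg (eta : R -> R) : Prop :=
  exists g : R -> R,
    (forall t, 0 <= t -> 0 <= eta t /\ g (eta t) = t) /\
    (forall t, 0 <= t -> 0 <= g t /\ eta (g t) = t) /\
    {within `[0, +oo[, continuous eta} /\ {within `[0, +oo[, continuous g}.

Definition quasisymmetric_onto (gamma : set pt) (f : R -> pt) : Prop :=
  set_fun `[0, 1] gamma f /\ {in `[0, 1] &, injective f} /\ f @` `[0, 1] = gamma /\
  exists eta : R -> R, homeo_nonneg eta /\
    forall x y z t, x \in `[0, 1] -> y \in `[0, 1] -> z \in `[0, 1] -> 0 <= t ->
      `|x - y| <= t * `|x - z| -> eucl_dist (f x) (f y) <= eta t * eucl_dist (f x) (f z).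

Definition quasiarc (gamma : set pt) : Prop :=
  exists f : R -> pt, quasisymmetric_onto gamma f.

End Defs.

(* Main.v *)
Require Import Defs.
From mathcomp Require Import all_boot all_order all_algebra.
From mathcomp Require Import all_classical all_reals all_analysis.
From mathcomp Require Import ring lra.
Import Order.TTheory GRing.Theory Num.Theory.
Import numFieldNormedType.Exports.
Local Open Scope classical_set_scope.
Local Open Scope ring_scope.
(* The functional equation phi (s_i t) = S_i (phi t) makes the two-sided Hoelder
   estimate invariant under zooming: S_i scales distances by r_i and s_i scales
   lengths by r_i^s.  So it suffices to treat u and v in different first-level
   intervals.  If these are not adjacent, both |u - v| and |phi u - phi v| are
   bounded below.  If they are adjacent with common endpoint t, the estimates for
   the pairs (u, t) and (t, v) reduce, again by zooming, to the pairs (u, 1) and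
   (0, v), which hold for every nondegenerate IFS arc; only the passage from those
   to the lower bound for (u, v) needs gamma to be a quasiarc.  There, phi t
   separates gamma, so it lies between phi u and phi v in any parameterization,
   and weak quasisymmetry gives |phi u - phi t| <= H |phi u - phi v|.
   Conversely, a bi-Hoelder phi is itself a quasisymmetric parameterization, with
   eta t = K^2 t^(1/s). *)

Set Implicit Arguments.
Unset Strict Implicit.

(** * The Euclidean metric *)

Section EuclideanDistance.
Variables (R : realType) (n : nat).
Implicit Types x y z : 'rV[R]_n.

(** With [X] and [Y] the two norms, summing (Y f_i - X g_i)^2 >= 0 and dividing by 2XY gives the
    claim. If XY = 0, one of the families vanishes and so does the left side. *)
Lemma cauchy_schwarz_sum (I : finType) (f g : I -> R) :
  \sum_i f i * g i <=
  Num.sqrt (\sum_i f i ^+ 2) * Num.sqrt (\sum_i g i ^+ 2).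
Proof.
set F := \sum_i f i ^+ 2; set G := \sum_i g i ^+ 2.
have F0 : 0 <= F by apply: sumr_ge0 => i _; exact: sqr_ge0.
have G0 : 0 <= G by apply: sumr_ge0 => i _; exact: sqr_ge0.
set X := Num.sqrt F; set Y := Num.sqrt G.
have XX : X ^+ 2 = F by rewrite sqr_sqrtr.
have YY : Y ^+ 2 = G by rewrite sqr_sqrtr.
have X0 : 0 <= X by exact: sqrtr_ge0.
have Y0 : 0 <= Y by exact: sqrtr_ge0.
have [XY0|XY0] := eqVneq (X * Y) 0.
  rewrite XY0 big1// => i _; move/eqP: XY0; rewrite mulf_eq0 => /orP[]/eqP E.
    have /eqP : F = 0 by rewrite -XX E expr0n.
    rewrite psumr_eq0; last by move=> j _; exact: sqr_ge0.
    by move=> /allP/(_ i (mem_index_enum _)); rewrite sqrf_eq0 => /eqP->; rewrite mul0r.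
  have /eqP : G = 0 by rewrite -YY E expr0n.
  rewrite psumr_eq0; last by move=> j _; exact: sqr_ge0.
  by move=> /allP/(_ i (mem_index_enum _)); rewrite sqrf_eq0 => /eqP->; rewrite mulr0.
have XYgt0 : 0 < X * Y by rewrite lt0r XY0 mulr_ge0.
suff : (2 * (X * Y)) * \sum_i f i * g i <= (2 * (X * Y)) * (X * Y).
  by rewrite ler_pM2l// mulr_gt0.
have -> : 2 * (X * Y) * (X * Y) = Y ^+ 2 * F + X ^+ 2 * G by rewrite -XX -YY; ring.
rewrite /F /G !mulr_sumr -big_split/=; apply: ler_sum => i _.
rewrite -subr_ge0.
have -> : Y ^+ 2 * f i ^+ 2 + X ^+ 2 * g i ^+ 2 - 2 * (X * Y) * (f i * g i) =
  (Y * f i - X * g i) ^+ 2 by ring.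
exact: sqr_ge0.
Qed.

Lemma eucl_dist_ge0 x y : 0 <= eucl_dist x y.
Proof. exact: sqrtr_ge0. Qed.

Lemma eucl_distxx x : eucl_dist x x = 0.
Proof.
by rewrite /eucl_dist big1 ?sqrtr0// => i _; rewrite subrr expr0n.
Qed.

Lemma eucl_distC x y : eucl_dist x y = eucl_dist y x.
Proof.
by rewrite /eucl_dist; congr Num.sqrt; apply: eq_bigr => i _; rewrite -sqrrN opprB.
Qed.

Lemma eucl_dist_triangle x y z :
  eucl_dist x z <= eucl_dist x y + eucl_dist y z.
Proof.
rewrite -(@ler_pXn2r _ 2%N)// ?nnegrE ?addr_ge0 ?eucl_dist_ge0//.
have S0 (u v : 'rV[R]_n) : 0 <= \sum_(i < n) (u 0 i - v 0 i) ^+ 2.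
  by apply: sumr_ge0 => i _; exact: sqr_ge0.
have CS := cauchy_schwarz_sum (fun i => x 0 i - y 0 i) (fun i => y 0 i - z 0 i).
have -> : eucl_dist x z ^+ 2 = eucl_dist x y ^+ 2 + eucl_dist y z ^+ 2 +
    2 * \sum_i (x 0 i - y 0 i) * (y 0 i - z 0 i).
  rewrite /eucl_dist !sqr_sqrtr// mulr_sumr -!big_split/=.
  by apply: eq_bigr => i _; ring.
rewrite sqrrD; move: CS; rewrite -/(eucl_dist x y) -/(eucl_dist y z).
by rewrite mulr2n => CS; lra.
Qed.

Lemma coord_le_eucl_dist x y i : `|x 0 i - y 0 i| <= eucl_dist x y.
Proof.
rewrite -sqrtr_sqr ler_sqrt; last by apply: sumr_ge0 => j _; exact: sqr_ge0.
by rewrite (bigD1 i)//= lerDl; apply: sumr_ge0 => j _; exact: sqr_ge0.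
Qed.

Lemma normr_le_eucl_dist x y : `|x - y| <= eucl_dist x y.
Proof.
rewrite /Num.norm/= mx_normrE; apply: bigmax_le; first exact: eucl_dist_ge0.
by move=> [i j] _; rewrite /= ord1 !mxE; exact: coord_le_eucl_dist.
Qed.

(** The norm carrying the topology of row vectors is the maximum norm; this bound and the reverse
    one transfer topological facts to [eucl_dist]. The crude factor [n.+1] is positive even for
    [n = 0], so it can be divided by. *)
Lemma eucl_dist_le_normr x y : eucl_dist x y <= n.+1%:R * `|x - y|.
Proof.
have C0 : 0 <= n.+1%:R * `|x - y| by rewrite mulr_ge0.
rewrite -[leRHS]ger0_norm// -sqrtr_sqr ler_sqrt ?sqr_ge0//.
have H (i : 'I_n) : true -> (x 0 i - y 0 i) ^+ 2 <= `|x - y| ^+ 2.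
  move=> _; rewrite -[leLHS]real_normK ?num_real// ler_pXn2r ?nnegrE//.
  have -> : x 0 i - y 0 i = (x - y) 0 i by rewrite !mxE.
  rewrite [leRHS]/Num.norm/= mx_normrE.
  exact: (le_bigmax _ (fun ij : 'I_1 * 'I_n => `|(x - y) ij.1 ij.2|) (0, i)).
apply: (le_trans (ler_sum _ H)).
rewrite sumr_const card_ord -[leLHS]mulr_natl exprMn ler_wpM2r ?sqr_ge0//.
by rewrite -natrX ler_nat (leq_trans (leqnSn n))// -mulnn leq_pmulr.
Qed.

Lemma eucl_dist_eq0 x y : eucl_dist x y = 0 -> x = y.
Proof.
move=> d0; apply/eqP; rewrite -subr_eq0 -normr_eq0 eq_le normr_ge0 andbT -d0.
exact: normr_le_eucl_dist.
Qed.

Lemma continuous_eucl_dist :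
  continuous (fun p : 'rV[R]_n * 'rV[R]_n => eucl_dist p.1 p.2).
Proof.
move=> p; apply/cvgrPdist_le => e e0.
apply/(@nbhs_ballP R ('rV[R]_n * 'rV[R]_n)%type).
pose C : R := n.+1%:R; have C0 : 0 < C by [].
have Cd0 : 0 < e / (2 * C) by rewrite divr_gt0 ?mulr_gt0.
exists (e / (2 * C)) => //= q [].
rewrite -!ball_normE/= => q1 q2.
have H x y : `|x - y| < e / (2 * C) -> eucl_dist x y <= e / 2.
  move=> xy; apply: (le_trans (eucl_dist_le_normr x y)).
  rewrite -/C -ler_pdivlMl// (le_trans (ltW xy))// le_eqVlt.
  by apply/orP; left; apply/eqP; field; exact: lt0r_neq0.
have := H _ _ q1; have := H _ _ q2.
have := eucl_dist_triangle p.1 q.1 p.2; have := eucl_dist_triangle q.1 q.2 p.2.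
have := eucl_dist_triangle q.1 p.1 q.2; have := eucl_dist_triangle p.1 p.2 q.2.
rewrite (eucl_distC q.2 p.2) (eucl_distC q.1 p.1) ler_norml.
by move=> ? ? ? ? ? ?; apply/andP; split; lra.
Qed.

(** The distance attains its minimum on the compact product, and a zero minimum would be a common
    point. If the product is empty, any [d] will do. *)
Lemma compact_eucl_separated (A B : set 'rV[R]_n) : compact A -> compact B ->
  A `&` B = set0 ->
  exists2 d : R, 0 < d & forall x y, A x -> B y -> d <= eucl_dist x y.
Proof.
move=> cA cB AB0.
have [AB|AB] := pselect (A `*` B !=set0); last first.
  exists 1 => // x y Ax By; exfalso; apply: AB; exists (x, y); split => //.
have [|[x y] /set_mem [/= Ax By] xyP] :=
    @compact_EVT_min _ R (fun p => eucl_dist p.1 p.2) _ AB (compact_setX cA cB).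
  exact/continuous_subspaceT/continuous_eucl_dist.
exists (eucl_dist x y) => [|x' y' Ax' By'].
  rewrite lt0r eucl_dist_ge0 andbT; apply/negP => /eqP/eucl_dist_eq0 xy.
  have : (A `&` B) x by split => //; rewrite xy.
  by rewrite AB0.
by apply: (xyP (x', y')); rewrite inE.
Qed.

Lemma within_continuous_eucl (A : set R) (f : R -> 'rV[R]_n) :
  (forall x : R, A x -> forall e : R, 0 < e -> exists2 d : R, 0 < d &
     forall y : R, A y -> `|x - y| < d -> eucl_dist (f x) (f y) <= e) ->
  {within A, continuous f}.
Proof.
move=> H; apply/subspace_continuousP => x Ax; apply/cvgrPdist_le => e e0.
have [d d0 xd] := H x Ax e e0.
rewrite near_withinE; exists d => //= y /= yd Ay.
by apply: (le_trans (normr_le_eucl_dist _ _)); exact: xd.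
Qed.

Lemma closed_eucl (A : set 'rV[R]_n) x : closed A ->
  (forall e : R, 0 < e -> exists2 y, A y & eucl_dist x y <= e) -> A x.
Proof.
move=> cA H; apply: cA => B /nbhs_ballP[e /= e0 eB].
have [|y Ay xy] := H (e / 2); first by rewrite divr_gt0.
exists y; split => //; apply: eB; rewrite -ball_normE/=.
apply: (le_lt_trans (normr_le_eucl_dist _ _)); apply: (le_lt_trans xy); lra.
Qed.

Lemma compact_eucl_bounded (A : set 'rV[R]_n) : compact A ->
  exists2 M : R, 0 < M & forall x y, A x -> A y -> eucl_dist x y <= M.
Proof.
move=> cA; have /ex_strict_bound_gt0[M M0 /= AM] : bounded_set A.
  exact: compact_bounded.
exists (n.+1%:R * (M + M)); first by rewrite mulr_gt0// addr_gt0.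
move=> x y Ax Ay; apply: (le_trans (eucl_dist_le_normr x y)).
rewrite ler_pM2l//; apply: (le_trans (ler_normB _ _)).
by rewrite lerD// ltW//; exact: AM.
Qed.

End EuclideanDistance.

(** * Quasisymmetric parameterizations *)

Section Quasisymmetry.
Variables (R : realType) (n : nat).

(** The definition contains no monotonicity, so this takes an argument. If [c = eta 0] were
    positive, [g] would vanish at [c] only, and by the intermediate value theorem would take a small
    value [v > 0] on both sides of [c]. Both points equal [eta v], which forces [eta v = c] and
    [v = g c = 0]. *)
Lemma homeo_nonneg0 (eta : R -> R) : homeo_nonneg eta -> eta 0 = 0.
Proof.
move=> [g [etag [geta [_ gc]]]].
have [eta0_ge0 geta0] := etag 0 (lexx _).
apply/eqP; apply: contraT => c_neq0.
set c := eta 0 in eta0_ge0 geta0 c_neq0.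
have c0 : 0 < c by rewrite lt0r c_neq0.
have gpos t : 0 <= t -> t != c -> 0 < g t.
  move=> t0 tc; have [gt0 etagt] := geta t t0; rewrite lt0r gt0 andbT.
  by apply: contraNneq tc => gt_eq0; rewrite -etagt gt_eq0.
pose v := Num.min (g 0) (g (c + c)).
have v0 : 0 < v.
  rewrite lt_min !gpos// ?addr_ge0//; first by rewrite -subr_eq0 addrK.
  by rewrite eq_sym.
have [v1 v2] : v <= g 0 /\ v <= g (c + c) by rewrite /v !ge_min !lexx orbT.
have IVTg u w : 0 <= u -> u <= w -> Num.min (g u) (g w) <= v <= Num.max (g u) (g w) ->
    exists2 x, x \in `[u, w] & eta v = x.
  move=> u0 uw /IVT [//||x xuw gx].
    apply: continuous_subspaceW gc => x /=; rewrite !in_itv/= andbT.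
    by move=> /andP[+ _]; exact: le_trans.
  exists x => //; rewrite -gx; move: xuw; rewrite in_itv/= => /andP[ux _].
  by case: (geta x) => //; exact: le_trans ux.
have [|||x1 x1c e1] := IVTg 0 c; [by []|exact: ltW| |].
  by rewrite geta0 ge_min le_max v1 (ltW v0) orbT.
have [|||x2 x2c e2] := IVTg c (c + c); [exact: ltW|by rewrite lerDl ltW| |].
  by rewrite geta0 ge_min le_max v2 (ltW v0) orbT.
have vc : eta v = c.
  apply/eqP; rewrite eq_le; move: x1c x2c; rewrite !in_itv/= -e1 -e2.
  by move=> /andP[_ ->] /andP[-> _].
have [_ gv] := etag v (ltW v0).
by move: v0; rewrite -gv vc geta0 ltxx.
Qed.

(** Fix any [z] other than [x]. As [y] tends to [x], the ratio [t] of |x - y| to |x - z| tends to 0,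
    hence so does [eta t], which controls the distance from [f x] to [f y]. *)
Lemma quasisymmetric_continuous (gamma : set 'rV[R]_n) (f : R -> 'rV[R]_n) :
  quasisymmetric_onto gamma f -> {within `[0, 1], continuous f}.
Proof.
move=> [_ [_ [_ [eta [etaH qs]]]]]; have eta0 := homeo_nonneg0 etaH.
have {etaH} etac : {within `[0, +oo[, continuous eta} by case: etaH => g [? [? []]].
apply: within_continuous_eucl => x; rewrite /= in_itv/= => /andP[x0 x1] e e0.
have [z z01 xz] : exists2 z : R, 0 <= z <= 1 & x != z.
  have [->|xn0] := eqVneq x 0.
    by exists 1; rewrite ?ler01 ?lexx// eq_sym oner_eq0.
  by exists 0; rewrite ?ler01 ?lexx.
have D0 : 0 < `|x - z| by rewrite normr_gt0 subr_eq0.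
pose M := eucl_dist (f x) (f z); have M0 : 0 <= M by exact: eucl_dist_ge0.
have M1 : 0 < M + 1 by rewrite ltr_wpDl.
have /subspace_continuousP/(_ 0) := etac.
rewrite /= in_itv/= lexx => /(_ isT)/cvgrPdist_lt/(_ (e / (M + 1))).
rewrite divr_gt0// near_withinE => /(_ isT)/nbhs_ballP[d /= d0 etad].
exists (d * `|x - z|) => [|y]; first exact: mulr_gt0.
rewrite in_itv/= => /andP[y0 y1] xy; pose t := `|x - y| / `|x - z|.
have t0 : 0 <= t by rewrite divr_ge0.
have := qs x y z t; rewrite !in_itv/= x0 x1 y0 y1 => /(_ isT isT).
rewrite z01 t0 divfK ?gt_eqF// lexx => /(_ isT isT isT)/le_trans; apply.
have etat : `|eta 0 - eta t| < e / (M + 1).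
  apply: etad; last by rewrite in_itv/= t0.
  by rewrite -ball_normE/= sub0r normrN ger0_norm// ltr_pdivrMr.
rewrite eta0 sub0r normrN in etat.
have {}etat : eta t <= e / (M + 1) by apply: ltW; apply: le_lt_trans etat; exact: ler_norm.
rewrite -/M (@le_trans _ _ (e / (M + 1) * M))// ?ler_wpM2r//.
by rewrite -mulrA ler_piMr ?ltW// mulrC ltr_pdivrMr// mul1r ltrDl.
Qed.

(** Otherwise C ∩ A would be nonempty and both closed and open in [C], hence all of [C], although
    [y] lies in [B]. *)
Lemma connected_meets_closed_cover (T : topologicalType) (C A B : set T) x y :
  connected C -> closed A -> closed B -> C `<=` A `|` B ->
  (C `&` A) x -> (C `&` B) y -> exists2 z, C z & (A `&` B) z.
Proof.
move=> cC cA cB CAB CAx [Cy By]; apply: contrapT => CAB0.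
have CA_open : C `&` A = C `&` ~` B.
  apply/seteqP; split=> z [Cz]; first by move=> Az; split => // Bz; apply: CAB0; exists z.
  by case: (CAB z Cz).
have CA : C `&` A = C.
  apply: cC; [by exists x| |by exists A].
  by exists (~` B) => //; exact: closed_openC.
apply: CAB0; exists y => //; split => //.
by have : C y by []; rewrite -CA => -[].
Qed.

(* If two closed pieces of a quasiarc meet in the single point [z], then [z]
   lies between [x] and [y] in the parameterization whenever the pieces separate them. *)
Lemma quasiarc_bounded_turning (gamma : set 'rV[R]_n) : quasiarc gamma ->
  exists2 H : R, 1 <= H & forall (A B : set 'rV[R]_n) x y z,
    closed A -> closed B -> gamma = A `|` B -> A `&` B = [set z] ->
    A x -> B y -> eucl_dist x z <= H * eucl_dist x y.
Proof.
move=> [f qs]; have fc := quasisymmetric_continuous qs.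
case: qs => _ [_ [fsurj [eta [_ qs]]]].
exists (Num.max 1 (eta 1)); first by rewrite le_max lexx.
move=> A B x y z cA cB gammaE ABz Ax By.
have [p p01 fp] : (f @` `[0, 1]) x by rewrite fsurj gammaE; left.
have [q q01 fq] : (f @` `[0, 1]) y by rewrite fsurj gammaE; right.
(* A parameter of [z] between [p] and [q] suffices, by quasisymmetry with [t = 1]. It exists because
   the image of the interval between them is connected and meets both closed pieces. *)
suff [m m01 [fm pm]] : exists2 m, `[0, 1]%classic m & f m = z /\ `|p - m| <= `|p - q|.
  rewrite -fp -fq -fm (@le_trans _ _ (eta 1 * eucl_dist (f p) (f q)))//.
    by apply: qs; rewrite // mul1r.
  by rewrite ler_wpM2r ?eucl_dist_ge0// le_max lexx orbT.
pose I := `[Num.min p q, Num.max p q]%classic.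
have I01 : I `<=` `[0, 1].
  move=> m; rewrite /I /= !in_itv/=; move: p01 q01; rewrite /= !in_itv/=.
  by case: (leP p q) => _ /andP[p0 p1] /andP[q0 q1] /andP[mp mq]; apply/andP; split; lra.
have [Ip Iq] : I p /\ I q.
  by rewrite /I /= !in_itv/= !ge_min !le_max !lexx !orbT.
have [||||_ [m Im <-]] := @connected_meets_closed_cover _ (f @` I) A B x y _ cA cB.
- apply: connected_continuous_connected; first exact: segment_connected.
  exact: continuous_subspaceW fc.
- by rewrite -gammaE -fsurj => _ [m /I01 m01 <-]; exists m.
- by split => //; exists p.
- by split => //; exists q.
rewrite ABz => fm; exists m; first exact: I01.
split => //; move: Im; rewrite /I /= in_itv/=.
case: (leP p q) => pq /andP[m1 m2]; first by rewrite !ler0_norm; lra.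
by rewrite !ger0_norm; lra.
Qed.

End Quasisymmetry.

(** * Power functions as homeomorphisms of the closed half-line *)

Section PowerHomeomorphism.
Variable R : realType.

Lemma powR_within_continuous (k p : R) : 0 < p ->
  {within `[0, +oo[, continuous (fun t : R => k * t `^ p)}.
Proof.
move=> p0; apply/continuous_within_itvcyP; split=> [x|].
  move=> x0; have dx : derivable (fun t : R => t `^ p) x 1 by exact: derivable_powR.
  have cx := differentiable_continuous ((derivable1_diffP _ _).1 dx).
  by apply: cvgMr; exact: cx.
rewrite powR0 ?gt_eqF//; apply: cvgMr.
exact: powR_cvg0.
Qed.

Lemma powR_homeo_nonneg (k p : R) : 0 < k -> 0 < p ->
  homeo_nonneg (fun t => k * t `^ p).
Proof.
move=> k0 p0; have p_neq0 : p != 0 by rewrite gt_eqF.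
have kV : 0 <= k^-1 by rewrite invr_ge0 ltW.
(* The inverse (t/k)^(1/p) is written as a constant times a power, so that one continuity lemma
   serves both directions. *)
exists (fun t => k^-1 `^ p^-1 * t `^ p^-1); split; [|split]; last split.
- move=> t t0; split; first by rewrite mulr_ge0 ?powR_ge0 ?ltW.
  rewrite -powRM ?mulr_ge0 ?powR_ge0 ?(ltW k0)//.
  by rewrite mulKf ?gt_eqF// -powRrM mulfV// powRr1.
- move=> t t0; split; first by rewrite mulr_ge0 ?powR_ge0.
  by rewrite -powRM// -powRrM mulVf// powRr1 ?mulr_ge0// mulVKf ?gt_eqF.
- exact: powR_within_continuous.
- by apply: powR_within_continuous; rewrite invr_gt0.
Qed.

End PowerHomeomorphism.

(** * Uniform constants over finite families, and geometric decay *)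

Section Uniformity.
Variable R : realType.

Lemma uniform_gt0 (N : nat) (P : nat -> R -> Prop) :
  (forall i e e', P i e -> 0 < e' -> e' <= e -> P i e') ->
  (forall i, (i < N)%N -> exists2 e, 0 < e & P i e) ->
  exists2 e, 0 < e & forall i, (i < N)%N -> P i e.
Proof.
move=> Pmono; elim: N => [|N IH] H; first by exists 1.
have [e1 e10 P1] := IH (fun i iN => H i (ltnW iN)).
have [e2 e20 P2] := H N (ltnSn N).
have e0 : 0 < Num.min e1 e2 by rewrite lt_min e10.
exists (Num.min e1 e2) => // i; rewrite ltnS leq_eqVlt => /predU1P[->|iN].
  by apply: Pmono P2 _ _ => //; rewrite ge_min lexx orbT.
by apply: Pmono (P1 i iN) _ _ => //; rewrite ge_min lexx.
Qed.

Lemma expr_small (q M e : R) : 0 <= q < 1 -> 0 < e -> exists k, q ^+ k * M < e.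
Proof.
move=> /andP[q0 q1] e0.
have [M0|M0] := leP M 0; first by exists 0%N; rewrite expr0 mul1r (le_lt_trans M0).
have := @cvg_expr _ q; rewrite ger0_norm// => /(_ q1)/cvgrPdist_lt/(_ (e / M)).
rewrite divr_gt0// => /(_ isT)[k _ /(_ k (leqnn k))/=].
rewrite sub0r normrN ger0_norm ?exprn_ge0// ltr_pdivlMr// => ?.
by exists k.
Qed.

End Uniformity.

(** * The Hutchinson parameterization *)

Section HutchinsonParameterization.
Variables (R : realType) (n N : nat) (S : nat -> 'rV[R]_n -> 'rV[R]_n).
Variables (r : nat -> R) (gamma : set 'rV[R]_n) (a b : 'rV[R]_n) (s : R).
Hypothesis ifs : contracting_IFS N S r.
Hypothesis inv : invariant_set N S gamma.
Hypothesis path : IFS_path N S a b.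
Hypothesis dim : similarity_dimension N r s.

Lemma ratio_gt0 i : (i < N)%N -> 0 < r i.
Proof. by move=> iN; case: ifs => _ /(_ i iN)[/andP[]]. Qed.

Lemma ratio_lt1 i : (i < N)%N -> r i < 1.
Proof. by move=> iN; case: ifs => _ /(_ i iN)[/andP[]]. Qed.

Lemma similarity_dist i x y : (i < N)%N ->
  eucl_dist (S i x) (S i y) = r i * eucl_dist x y.
Proof. by move=> iN; case: ifs => _ /(_ i iN)[_ ->]. Qed.

Lemma similarity_inj i : (i < N)%N -> injective (S i).
Proof.
move=> iN x y Sxy; apply: eucl_dist_eq0.
have := similarity_dist x y iN; rewrite Sxy eucl_distxx => /esym/eqP.
by rewrite mulf_eq0 gt_eqF ?ratio_gt0// => /eqP.
Qed.

Lemma similarity_continuous i : (i < N)%N -> continuous (S i).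
Proof.
move=> iN x; apply/(@cvgrPdist_le _ _ _ (nbhs x)) => e e0; apply/nbhs_ballP.
have C0 : 0 < r i * n.+1%:R by rewrite mulr_gt0 ?ratio_gt0.
exists (e / (r i * n.+1%:R)) => /= [|y]; first exact: divr_gt0.
rewrite -ball_normE/= ltr_pdivlMr// mulrC => xy.
apply: (le_trans (normr_le_eucl_dist _ _)); rewrite similarity_dist//.
apply: le_trans (ltW xy); rewrite -mulrA ler_pM2l ?ratio_gt0//.
exact: eucl_dist_le_normr.
Qed.

Lemma piece_subset i x : (i < N)%N -> gamma x -> gamma (S i x).
Proof. by move=> iN gx; case: inv => _ [_ ->]; exists i => //; exists x. Qed.

Lemma pieceP x : gamma x -> exists i y, [/\ (i < N)%N, gamma y & x = S i y].
Proof. by case: inv => _ [_ {1}->] [i /= iN [y gy <-]]; exists i, y. Qed.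

Lemma compact_piece i : (i < N)%N -> compact (S i @` gamma).
Proof.
move=> iN; apply: continuous_compact; last by case: inv => _ [].
exact/continuous_subspaceT/similarity_continuous.
Qed.

Lemma closed_invariant_set : closed gamma.
Proof. by apply: compact_closed; [exact: norm_hausdorff|case: inv => _ []]. Qed.

Lemma interval_length_gt0 i : (i < N)%N -> 0 < r i `^ s.
Proof. by move=> iN; rewrite powR_gt0// ratio_gt0. Qed.

(** A common rate for the maps S_i in space and s_i in the parameter: the first gives geometric
    approximation, the second makes zooming terminate. *)
Lemma contraction_rate :
  exists2 q : R, 0 <= q < 1 & forall i, (i < N)%N -> r i <= q /\ r i `^ s <= q.
Proof.
(* The clause [e <= 1] makes the rate [q = 1 - e] nonnegative. *)
have [||e e0 eP] := @uniform_gt0 R N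
    (fun i e => e <= 1 /\ r i <= 1 - e /\ r i `^ s <= 1 - e).
- by move=> i e e' [? [? ?]] ? ?; split; [lra|split; lra].
- move=> i iN; have r0 := ratio_gt0 iN; have L0 := interval_length_gt0 iN.
  have r1 := ratio_lt1 iN.
  have L1 : r i `^ s < 1.
    case: dim => s0 _; have <- : 1 `^ s = 1 :> R by rewrite powR1.
    by rewrite gt0_ltr_powR ?nnegrE ?ltW.
  exists (Num.min (1 - r i) (1 - r i `^ s)); first by rewrite lt_min !subr_gt0 r1.
  split; last split.
  + by rewrite ge_min lerBlDr lerDl ltW.
  + by rewrite lerBrDr -lerBrDl ge_min lexx.
  + by rewrite lerBrDr -lerBrDl ge_min lexx orbT.
have N0 : (0 < N)%N by case: ifs => /ltnW.
have [e1 _] := eP 0%N N0.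
by exists (1 - e) => [|i /eP[_]//]; apply/andP; split; lra.
Qed.

(** Pull a point of [P] back through [k] maps, replace the result by a point of [Q], and push it
    forward again: the error is at most q^k M, and [Q] is closed. This one principle yields that
    fixed points lie in [gamma], and that [phi] maps into and onto [gamma]. *)
Lemma subset_of_self_similar (P Q : set 'rV[R]_n) (M : R) :
  (forall x, P x -> exists i y, [/\ (i < N)%N, P y & x = S i y]) ->
  (forall i y, (i < N)%N -> Q y -> Q (S i y)) ->
  (forall x y, P x -> Q y -> eucl_dist x y <= M) ->
  Q !=set0 -> closed Q -> P `<=` Q.
Proof.
move=> PP QQ PQM [y0 Qy0] cQ x Px; apply: closed_eucl => // e e0.
have [q q01 rq] := contraction_rate; have [k kM] := expr_small M q01 e0.
suff [y Qy xy] : exists2 y, Q y & eucl_dist x y <= q ^+ k * M.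
  by exists y => //; apply: le_trans xy (ltW kM).
elim: k x Px {kM} => [|k IH] x Px.
  by exists y0 => //; rewrite expr0 mul1r PQM.
have [i [x' [iN Px' ->]]] := PP x Px; have [y Qy xy] := IH x' Px'.
exists (S i y); first exact: QQ.
rewrite similarity_dist// exprS -mulrA.
apply: ler_pM => //; [exact/ltW/ratio_gt0|exact: eucl_dist_ge0|].
by case: (rq i iN).
Qed.

Lemma fixpoint_in_invariant_set i x : (i < N)%N -> S i x = x -> gamma x.
Proof.
move=> iN Sx; have [g0 [cg _]] := inv; have [y0 gy0] := g0.
have [M M0 gM] := compact_eucl_bounded cg.
apply: (@subset_of_self_similar [set x] gamma (eucl_dist x y0 + M)) => //.
- by move=> _ ->; exists i, x.
- exact: piece_subset.
- move=> _ y -> gy; apply: le_trans (eucl_dist_triangle x y0 y) _.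
  by rewrite lerD2l gM.
- exact: closed_invariant_set.
Qed.

Lemma N_gt0 : (0 < N)%N. Proof. by case: ifs => /ltnW. Qed.
Lemma N_pred : N.-1.+1 = N. Proof. by rewrite prednK ?N_gt0. Qed.
Lemma last_lt : (N.-1 < N)%N. Proof. by rewrite N_pred. Qed.

Lemma source_in : gamma a.
Proof. by apply: (fixpoint_in_invariant_set N_gt0); case: path. Qed.

Lemma target_in : gamma b.
Proof. by apply: (fixpoint_in_invariant_set last_lt); case: path => _ []. Qed.

(* For [N = 2] the case [a = b] is compatible with the definition of an IFS arc. *)
Lemma degenerate_invariant_set : a = b -> gamma `<=` [set a].
Proof.
move=> ab; have [_ [cg _]] := inv; have [M M0 gM] := compact_eucl_bounded cg.
have Sa i : (i < N)%N -> S i a = a.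
  elim: i => [|i IH] iN; first by case: path.
  by case: path => _ [_ /(_ i iN) <-]; rewrite -ab IH// ltnW.
apply: (@subset_of_self_similar gamma [set a] M).
- exact: pieceP.
- by move=> i y iN ->; exact: Sa.
- by move=> x y gx ->; exact: gM source_in.
- by exists a.
- exact/accessible_closed_set1/hausdorff_accessible/norm_hausdorff.
Qed.

(** * The subdivision of the unit interval *)

Lemma tpt0 : tpt r s 0 = 0.
Proof. by rewrite /tpt big_ord0. Qed.

Lemma tptS i : tpt r s i.+1 = tpt r s i + r i `^ s.
Proof. by rewrite /tpt big_ord_recr. Qed.

Lemma tptN : tpt r s N = 1.
Proof. by case: dim. Qed.

Lemma le_tpt i j : (i <= j)%N -> tpt r s i <= tpt r s j.
Proof.
elim: j => [|j IH]; first by rewrite leqn0 => /eqP->.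
rewrite leq_eqVlt => /predU1P[->//|]; rewrite ltnS => /IH/le_trans; apply.
by rewrite tptS lerDl powR_ge0.
Qed.

Lemma sparE i u : spar r s i u = tpt r s i + u * r i `^ s.
Proof. by rewrite /spar tptS; ring. Qed.

Lemma spar0 i : spar r s i 0 = tpt r s i.
Proof. by rewrite sparE mul0r addr0. Qed.

Lemma spar1 i : spar r s i 1 = tpt r s i.+1.
Proof. by rewrite sparE mul1r tptS. Qed.

Lemma spar_subE i u v : spar r s i u - spar r s i v = (u - v) * r i `^ s.
Proof. by rewrite !sparE; ring. Qed.

Lemma spar_bounds i u : 0 <= u <= 1 -> tpt r s i <= spar r s i u <= tpt r s i.+1.
Proof.
move=> /andP[u0 u1]; rewrite sparE tptS lerDl lerD2l.
by rewrite mulr_ge0 ?powR_ge0//= ler_piMl ?powR_ge0.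
Qed.

Lemma tpt_bounds i : (i <= N)%N -> 0 <= tpt r s i <= 1.
Proof. by move=> iN; rewrite -tpt0 -tptN !le_tpt. Qed.

Lemma spar_unit i u : (i < N)%N -> 0 <= u <= 1 -> 0 <= spar r s i u <= 1.
Proof.
move=> iN /(spar_bounds i)/andP[u0 u1].
have /andP[t0 _] := tpt_bounds (ltnW iN); have /andP[_ t1] := tpt_bounds iN.
by rewrite (le_trans t0 u0) (le_trans u1 t1).
Qed.

Lemma spar_cover t : 0 <= t <= 1 ->
  exists i u, [/\ (i < N)%N, 0 <= u <= 1 & t = spar r s i u].
Proof.
move=> /andP[t0 t1].
have [i [iN ti it]] : exists i, [/\ (i < N)%N, tpt r s i <= t & t <= tpt r s i.+1].
  (* Descend from [m = N] until the left endpoint of the interval is at most [t]; this happens at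
     the latest at t_0 = 0. *)
  suff H m : (m <= N)%N -> (0 < m)%N -> t <= tpt r s m ->
      exists i, [/\ (i < N)%N, tpt r s i <= t & t <= tpt r s i.+1].
    by apply: (H N) => //; [exact: N_gt0|rewrite tptN].
  elim: m => // m IH mN _ tm.
  have [ltm|ltm] := leP (tpt r s m) t; first by exists m.
  apply: IH; [exact: ltnW| |exact: ltW].
  by case: m ltm {mN tm} => //; rewrite tpt0 ltNge t0.
have L0 := interval_length_gt0 iN.
exists i, ((t - tpt r s i) / r i `^ s); split=> //; last first.
  by rewrite sparE divfK ?gt_eqF// addrC subrK.
by rewrite divr_ge0 ?subr_ge0 ?powR_ge0// ler_pdivrMr// mul1r lerBlDr addrC -tptS.
Qed.

(* Zoom in until [u] and [v] lie in different first-level intervals; each step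
   stretches [v - u] by a factor bounded away from 1. *)
Lemma scaling_ind (Q : R -> R -> Prop) :
  (forall u, 0 <= u <= 1 -> Q u u) ->
  (forall i u v, (i < N)%N -> 0 <= u <= 1 -> 0 <= v <= 1 -> Q u v ->
     Q (spar r s i u) (spar r s i v)) ->
  (forall i j u v, (i < j)%N -> (j < N)%N -> 0 <= u <= 1 -> 0 <= v <= 1 ->
     Q (spar r s i u) (spar r s j v)) ->
  forall u v, 0 <= u -> u <= v -> v <= 1 -> Q u v.
Proof.
move=> Qrefl Qscale Qbase u v u0; rewrite le_eqVlt => /predU1P[<- u1|uv v1].
  by apply: Qrefl; rewrite u0.
have [q q01 rq] := contraction_rate; have /andP[q0 q1] := q01.
have vu0 : 0 < v - u by rewrite subr_gt0.
(* Induction on [k] with q^k < v - u: a zoom divides the length by some r_i^s <= q, so the bound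
   passes to the preceding power, and [k = 0] would mean v - u > 1. *)
have [k kuv] := expr_small 1 q01 vu0; rewrite mulr1 in kuv.
clear vu0; elim: k u v u0 v1 uv kuv => [|k IH] u v u0 v1 uv kuv.
  by move: kuv; rewrite expr0 => kuv; exfalso; lra.
have [|i [u' [iN u'01 uE]]] := @spar_cover u; first by apply/andP; split; lra.
have [|j [v' [jN v'01 vE]]] := @spar_cover v; first by apply/andP; split; lra.
have [ij|ji|ij] := ltngtP i j; rewrite uE vE.
- exact: Qbase.
(* For j < i, v <= t_{j+1} <= t_i <= u contradicts u < v. *)
- exfalso; have := le_tpt ji; have /andP[+ _] := spar_bounds i u'01.
  by have /andP[_] := spar_bounds j v'01; rewrite -uE -vE => ? ? ?; lra.
- rewrite -ij in vE *; have L0 := interval_length_gt0 iN; have [_ Lq] := rq i iN.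
  have uvE : v - u = (v' - u') * r i `^ s by rewrite uE vE spar_subE.
  apply: Qscale => //; case/andP: u'01 => u'0 _; case/andP: v'01 => _ v'1.
  apply: IH => //.
    by rewrite -subr_gt0 -(pmulr_lgt0 _ L0) -uvE subr_gt0.
  rewrite -(ltr_pM2r L0) -uvE; apply: le_lt_trans kuv.
  by rewrite exprSr ler_wpM2l// exprn_ge0.
Qed.

(** * The functional equation of [phi] and its image *)

Variable phi : R -> 'rV[R]_n.
Hypothesis hut : hutchinson_param N S r s a b phi.

Lemma phik_total k t : 0 <= t <= 1 -> exists x, phik N S r s a b k t x.
Proof.
elim: k t => [|k IH] t t01.
  by exists (phi0 a b t), [::], t.
have [i [u [iN u01 ->]]] := spar_cover t01.
have [x [w [v [wk [wN [v01 [-> _]]]]]]] := IH u u01.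
by exists (Sword S (i :: w) (phi0 a b v)), (i :: w), v; rewrite /= wk iN.
Qed.

(** Prefixing a word with [i] turns a value [x] of level [k] at [t] into the value S_i x of level
    k+1 at s_i(t). The equation then passes to the limit; the tolerance e/(1 + r_i) makes the two
    errors add up to [e]. *)
Lemma phi_spar i t : (i < N)%N -> 0 <= t <= 1 -> phi (spar r s i t) = S i (phi t).
Proof.
move=> iN t01; apply: eucl_dist_eq0; apply/eqP; rewrite eq_le eucl_dist_ge0 andbT.
apply/ler_addgt0Pl => e e0; rewrite addr0.
have r0 := ratio_gt0 iN; have r1 : 0 < 1 + r i by rewrite addr_gt0.
have [|k hk] := hut (eps := e / (1 + r i)); first exact: divr_gt0.
have [x [w [u [wk [wN [u01 [tE _]]]]]]] := phik_total k t01.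
have d1 : eucl_dist (phi t) (Sword S w (phi0 a b u)) <= e / (1 + r i).
  by apply: (hk k (leqnn k)); exists w, u.
have d2 : eucl_dist (phi (spar r s i t)) (Sword S (i :: w) (phi0 a b u)) <= e / (1 + r i).
  by apply: (hk k.+1 (leqnSn k)); exists (i :: w), u; rewrite /= wk iN -tE.
apply: le_trans (eucl_dist_triangle _ (S i (Sword S w (phi0 a b u))) _) _.
rewrite (eucl_distC _ (S i (phi t))) similarity_dist//.
have -> : e = e / (1 + r i) + r i * (e / (1 + r i)) by field; exact: lt0r_neq0.
by rewrite lerD// ler_pM2l.
Qed.

Lemma similarity_fixpoint_unique i x y : (i < N)%N -> S i x = x -> S i y = y -> x = y.
Proof.
move=> iN Sx Sy; apply: eucl_dist_eq0; have := similarity_dist x y iN.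
rewrite Sx Sy => /eqP; rewrite -subr_eq0 -{1}[eucl_dist x y]mul1r -mulrBl mulf_eq0.
by rewrite subr_eq0 gt_eqF ?ratio_lt1// => /eqP.
Qed.

Lemma phi_source : phi 0 = a.
Proof.
apply: (similarity_fixpoint_unique N_gt0); last by case: path.
by rewrite -phi_spar ?N_gt0 ?lexx ?ler01// spar0 tpt0.
Qed.

Lemma phi_target : phi 1 = b.
Proof.
apply: (similarity_fixpoint_unique last_lt); last by case: path => _ [].
by rewrite -phi_spar ?last_lt ?lexx ?ler01// spar1 N_pred tptN.
Qed.

Lemma Sword_lipschitz w x y : all (fun i => (i < N)%N) w ->
  eucl_dist (Sword S w x) (Sword S w y) <= eucl_dist x y.
Proof.
elim: w => //= i w IH /andP[iN wN]; rewrite similarity_dist//.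
apply: le_trans (IH wN); rewrite ler_piMl ?eucl_dist_ge0//.
exact/ltW/ratio_lt1.
Qed.

Lemma Sword_in w x : all (fun i => (i < N)%N) w -> gamma x -> gamma (Sword S w x).
Proof. by elim: w => //= i w IH /andP[iN wN] gx; exact: piece_subset (IH wN gx). Qed.

(** By the functional equation the image of [phi] is self-similar, so [subset_of_self_similar]
    applies once its distances to [gamma] are bounded. *)
Lemma phi_in t : 0 <= t <= 1 -> gamma (phi t).
Proof.
move=> t01; have [_ [cg _]] := inv; have [M M0 gM] := compact_eucl_bounded cg.
pose C := n.+1%:R * `|b - a|.
have phi0C u : 0 <= u <= 1 -> eucl_dist (phi0 a b u) a <= C.
  move=> /andP[u0 u1]; apply: le_trans (eucl_dist_le_normr _ _) _.
  rewrite ler_pM2l// /phi0 addrC addKr normrZ ger0_norm//.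
  by rewrite ler_piMl.
suff : phi @` `[0, 1] `<=` gamma by apply; exists t.
apply: (@subset_of_self_similar _ _ (1 + (C + M))).
- move=> _ [u /= u01 <-]; rewrite in_itv/= in u01.
  have [i [v [iN v01 ->]]] := spar_cover u01.
  by exists i, (phi v); split => //; [exists v => //=; rewrite in_itv|rewrite phi_spar].
- by move=> i y; exact: piece_subset.
(* The point [phi u] is within 1 of some S_w(phi_0(v)), which is within [C] of S_w(a); the latter
   lies in [gamma], where distances are at most [M]. *)
- move=> _ y [u /= u01 <-] gy; rewrite in_itv/= in u01.
  have [k hk] := hut (@ltr01 R).
  have [x phix] := phik_total k u01; have ux := hk k (leqnn k) _ _ phix.
  case: phix => w [v [wk [wN [v01 [_ xE]]]]].
  apply: le_trans (eucl_dist_triangle _ x _) _; apply: lerD => //.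
  apply: le_trans (eucl_dist_triangle _ (Sword S w a) _) _; rewrite xE lerD//.
    exact: le_trans (Sword_lipschitz _ _ wN) (phi0C v v01).
  by apply: gM => //; exact: Sword_in source_in.
- by exists a; exact: source_in.
- exact: closed_invariant_set.
Qed.

(** * Two-sided Hoelder estimates *)

Let gauge (u v : R) := `|u - v| `^ s^-1.
Let holder_at (c C u v : R) :=
  c * gauge u v <= eucl_dist (phi u) (phi v) <= C * gauge u v.

Lemma exponent_gt0 : 0 < s^-1.
Proof. by rewrite invr_gt0; case: dim. Qed.

Lemma gauge_ge0 u v : 0 <= gauge u v.
Proof. exact: powR_ge0. Qed.

(** This is why the subdivision uses lengths r_i^s: their power 1/s is exactly the ratio of S_i. *)
Lemma gauge_spar i u v : (i < N)%N ->
  gauge (spar r s i u) (spar r s i v) = r i * gauge u v.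
Proof.
move=> iN; rewrite /gauge spar_subE normrM powRM// (ger0_norm (powR_ge0 _ _)).
rewrite -powRrM mulfV ?gt_eqF//; last by case: dim.
by rewrite powRr1 1?mulrC// ltW// ratio_gt0.
Qed.

Lemma le_gauge u v u' v' : `|u - v| <= `|u' - v'| -> gauge u v <= gauge u' v'.
Proof. by move=> uv; rewrite /gauge ge0_ler_powR ?nnegrE ?(ltW exponent_gt0). Qed.

Lemma gauge_le1 u v : 0 <= u <= 1 -> 0 <= v <= 1 -> gauge u v <= 1.
Proof.
move=> /andP[u0 u1] /andP[v0 v1]; have -> : 1 = gauge 1 0.
  by rewrite /gauge subr0 normr1 powR1.
apply: le_gauge; rewrite subr0 normr1 ler_norml; apply/andP; split; lra.
Qed.

Lemma holder_refl c C u : holder_at c C u u.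
Proof.
rewrite /holder_at /gauge subrr normr0 powR0 ?gt_eqF ?exponent_gt0//.
by rewrite eucl_distxx !mulr0 lexx.
Qed.

Lemma holder_sym c C u v : holder_at c C u v -> holder_at c C v u.
Proof. by rewrite /holder_at /gauge distrC eucl_distC. Qed.

Lemma holder_spar c C i u v : (i < N)%N -> 0 <= u <= 1 -> 0 <= v <= 1 ->
  holder_at c C u v -> holder_at c C (spar r s i u) (spar r s i v).
Proof.
move=> iN u01 v01; rewrite /holder_at gauge_spar// !phi_spar// similarity_dist//.
by rewrite !(mulrCA _ (r i)) !ler_pM2l ?ratio_gt0.
Qed.

Lemma holder_weaken c C c' C' u v : c' <= c -> C <= C' ->
  holder_at c C u v -> holder_at c' C' u v.
Proof.
move=> cc CC /andP[lo hi]; apply/andP; split.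
  by apply: le_trans lo; rewrite ler_wpM2r ?gauge_ge0.
by apply: (le_trans hi); rewrite ler_wpM2r ?gauge_ge0.
Qed.

(** The gauge lies between m^(1/s) and 1, so constant bounds on the distance become Hoelder
    bounds. *)
Lemma holder_far m M c u v : 0 <= u <= 1 -> 0 <= v <= 1 -> 0 < m -> 0 <= c -> 0 <= M ->
  m <= `|u - v| -> c <= eucl_dist (phi u) (phi v) <= M ->
  holder_at c (M / m `^ s^-1) u v.
Proof.
move=> u01 v01 m0 c0 M0 muv /andP[cd dM]; apply/andP; split.
  by apply: le_trans cd; rewrite ler_piMr ?gauge_le1.
have mp0 : 0 < m `^ s^-1 by rewrite powR_gt0.
apply: (le_trans dM); rewrite mulrAC ler_pdivlMr// ler_wpM2l//.
by rewrite /gauge ge0_ler_powR ?nnegrE ?(ltW m0) ?(ltW exponent_gt0).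
Qed.

(** The longer of [u, t] and [t, v] has at least half the length of [u, v], which costs 2^(1/s) in
    the lower bound, and passing to the pair (u, v) costs [H]. The upper bound is the triangle
    inequality. *)
Lemma holder_join c C H u t v : 0 <= c -> 0 <= C -> 0 < H -> u <= t <= v ->
  eucl_dist (phi u) (phi t) <= H * eucl_dist (phi u) (phi v) ->
  eucl_dist (phi t) (phi v) <= H * eucl_dist (phi u) (phi v) ->
  holder_at c C u t -> holder_at c C t v ->
  holder_at (c / (H * 2 `^ s^-1)) (C + C) u v.
Proof.
move=> c0 C0 H0 /andP[ut tv] dut dtv /andP[lo1 hi1] /andP[lo2 hi2].
have p2 : 0 < 2 `^ s^-1 :> R by rewrite powR_gt0.
have double x y : `|u - v| <= 2 * `|x - y| -> gauge u v <= 2 `^ s^-1 * gauge x y.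
  move=> uv; rewrite /gauge -powRM//.
  by rewrite ge0_ler_powR ?nnegrE ?mulr_ge0 ?(ltW exponent_gt0).
apply/andP; split; last first.
  apply: le_trans (eucl_dist_triangle _ (phi t) _) _; rewrite mulrDl; apply: lerD.
    apply: (le_trans hi1); apply: ler_wpM2l => //; apply: le_gauge.
    by rewrite !ler0_norm; lra.
  apply: (le_trans hi2); apply: ler_wpM2l => //; apply: le_gauge.
  by rewrite !ler0_norm; lra.
have lower x y : gauge u v <= 2 `^ s^-1 * gauge x y ->
    c * gauge x y <= H * eucl_dist (phi u) (phi v) ->
    c / (H * 2 `^ s^-1) * gauge u v <= eucl_dist (phi u) (phi v).
  move=> guv cg; rewrite mulrAC ler_pdivrMr ?mulr_gt0//.
  apply: (le_trans (ler_wpM2l c0 guv)); rewrite mulrCA [leRHS]mulrC -[leRHS]mulrA.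
  by rewrite [leRHS]mulrCA ler_pM2l//.
have [le1|le1] := leP (t - u) (v - t).
  apply: (lower t v); last exact: le_trans lo2 dtv.
  by apply: double; rewrite !ler0_norm; lra.
apply: (lower u t); last exact: le_trans lo1 dut.
by apply: double; rewrite !ler0_norm; lra.
Qed.

Lemma min_interval_length :
  exists2 m, 0 < m & forall i, (i < N)%N -> m <= r i `^ s.
Proof.
apply: (uniform_gt0 (P := fun i e => e <= r i `^ s)).
  by move=> i e e' He _ /le_trans; apply.
by move=> i iN; exists (r i `^ s) => //; exact: interval_length_gt0.
Qed.

(** * Separation of the pieces of an arc *)

Hypothesis touch : forall i, (i.+1 < N)%N ->
  S i @` gamma `&` S i.+1 @` gamma = [set S i.+1 a].
Hypothesis apart : forall i j, (i < N)%N -> (j < N)%N -> (i.+1 < j)%N ->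
  S i @` gamma `&` S j @` gamma = set0.

(** Since [a] lies in piece 0, only piece 1 could also contain it. Then [a] would be the contact
    point S_1(a) = S_0(b), and S_0(a) = S_0(b) gives a = b. *)
Lemma source_notin i : a <> b -> (0 < i < N)%N -> ~ (S i @` gamma) a.
Proof.
move=> ab /andP[i0 iN] Sia; have [Sa _] := path.
have S0a : (S 0%N @` gamma) a by exists a => //; exact: source_in.
case: i i0 iN Sia => [//|[|i]] _ iN Sia.
  have : (S 0%N @` gamma `&` S 1%N @` gamma) a by [].
  rewrite touch// => /= aE; apply: ab; apply: (similarity_inj N_gt0).
  by case: path => _ [_ ->] //; rewrite Sa.
have : (S 0%N @` gamma `&` S i.+2 @` gamma) a by [].
by rewrite apart// N_gt0.
Qed.

(** Mirror image of [source_notin]: the contact point of the last two pieces is S_{N-1}(a), while b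
    = S_{N-1}(b). *)
Lemma target_notin i : a <> b -> (i.+1 < N)%N -> ~ (S i @` gamma) b.
Proof.
move=> ab iN Sib; have [_ [Sb _]] := path.
have SNb : (S N.-1 @` gamma) b by exists b => //; exact: target_in.
have [iN1|iN1] := eqVneq i.+1 N.-1.
  have : (S i @` gamma `&` S i.+1 @` gamma) b by rewrite iN1.
  rewrite touch// iN1 => /= bE; apply: ab; apply: (similarity_inj last_lt).
  by rewrite -bE Sb.
have : (S i @` gamma `&` S N.-1 @` gamma) b by [].
rewrite apart//; [exact: ltnW|exact: last_lt|].
by rewrite ltn_neqAle iN1 -ltnS N_pred.
Qed.

Lemma source_target_separation : a <> b -> exists2 e, 0 < e & forall i x,
  (i < N)%N -> gamma x ->
  ((0 < i)%N -> e <= eucl_dist a (S i x)) /\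
  ((i.+1 < N)%N -> e <= eucl_dist (S i x) b).
Proof.
move=> ab.
have [||e e0 eP] := @uniform_gt0 R N (fun i e => forall x, gamma x ->
    ((0 < i)%N -> e <= eucl_dist a (S i x)) /\
    ((i.+1 < N)%N -> e <= eucl_dist (S i x) b)).
- move=> i e e' He _ e'e x gx; have [h1 h2] := He x gx.
  by split=> [/h1|/h2]; exact: le_trans.
- move=> i iN; have cSi := compact_piece iN.
  have [e1 e10 e1P] : exists2 e, 0 < e & forall x, gamma x -> (0 < i)%N ->
      e <= eucl_dist a (S i x).
    have [i0|i0] := boolP (0 < i)%N; last by exists 1.
    have [|e e0 eP] := compact_eucl_separated (@compact_set1 _ a) cSi.
      by apply/seteqP; split => // x [/= -> /source_notin]; apply; rewrite // i0.
    by exists e => // x gx _; apply: eP => //; exact: imageP.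
  have [e2 e20 e2P] : exists2 e, 0 < e & forall x, gamma x -> (i.+1 < N)%N ->
      e <= eucl_dist (S i x) b.
    have [i0|i0] := boolP (i.+1 < N)%N; last by exists 1.
    have [|e e0 eP] := compact_eucl_separated cSi (@compact_set1 _ b).
      by apply/seteqP; split => // x [/[swap] /= -> /target_notin]; apply.
    by exists e => // x gx _; apply: eP => //; exact: imageP.
  exists (Num.min e1 e2) => [|x gx]; first by rewrite lt_min e10.
  by split=> h; rewrite ge_min ?e1P ?e2P ?orbT.
by exists e => // i x iN gx; exact: eP.
Qed.

Lemma piece_separation : exists2 e, 0 < e & forall i j x y,
  (i.+1 < j)%N -> (j < N)%N -> gamma x -> gamma y -> e <= eucl_dist (S i x) (S j y).
Proof.
have [||e e0 eP] := @uniform_gt0 R N (fun i e => forall j, (j < N)%N ->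
    forall x y, (i.+1 < j)%N -> gamma x -> gamma y -> e <= eucl_dist (S i x) (S j y)).
- by move=> i e e' He _ e'e j jN x y ij gx gy; apply: le_trans e'e (He _ _ _ _ _ _ _).
- move=> i iN; apply: (uniform_gt0 (P := fun j e => forall x y, (i.+1 < j)%N ->
      gamma x -> gamma y -> e <= eucl_dist (S i x) (S j y))).
    by move=> j e e' He _ e'e x y ij gx gy; apply: le_trans e'e (He _ _ _ _ _).
  move=> j jN; have [ij|ij] := boolP (i.+1 < j)%N; last by exists 1.
  have [e e0 eP] := compact_eucl_separated (compact_piece iN) (compact_piece jN) (apart iN jN ij).
  by exists e => // x y _ gx gy; apply: eP; exact: imageP.
exists e => // i j x y ij jN; apply: eP => //.
by rewrite (ltn_trans _ jN)// (ltn_trans _ ij).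
Qed.

(** Here [M] bounds the distances in [gamma] and [m] the lengths r_i^s from below; both are fixed
    before [c], so the upper constant is the same in all uses. *)
Lemma far_bound : exists2 m, 0 < m & exists2 M, 0 < M & forall c u v, 0 <= c ->
  0 <= u <= 1 -> 0 <= v <= 1 ->
  (exists2 i, (i < N)%N & r i `^ s <= `|u - v|) -> c <= eucl_dist (phi u) (phi v) ->
  holder_at c (M / m `^ s^-1) u v.
Proof.
have [_ [cg _]] := inv; have [M M0 gM] := compact_eucl_bounded cg.
have [m m0 mL] := min_interval_length.
exists m => //; exists M => // c u v c0 u01 v01 [i iN iuv] cd.
apply: holder_far => //; first exact: ltW.
  exact: le_trans (mL i iN) iuv.
by rewrite cd gM//; exact: phi_in.
Qed.

(** The condition survives zooming: s_i(u) = 0 forces u = 0, and s_i(v) = 1 forces v = 1. When the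
    first-level intervals differ, the whole first or last interval lies between the parameters, and
    the other point lies in a piece at positive distance from [a] or [b]. *)
Lemma holder_endpoints : a <> b -> exists c C, [/\ 0 < c, 0 < C & forall u v,
  0 <= u -> u <= v -> v <= 1 -> u = 0 \/ v = 1 -> holder_at c C u v].
Proof.
move=> ab; have [c c0 cP] := source_target_separation ab.
have [m m0 [M M0 far]] := far_bound.
exists c, (M / m `^ s^-1); split => //; first by rewrite divr_gt0 ?powR_gt0.
apply: scaling_ind => [u _ _|i u v iN u01 v01 H uv|i j u v ij jN u01 v01 uv].
- exact: holder_refl.
- have L0 := interval_length_gt0 iN.
  apply: holder_spar => //; apply: H; case: uv => [u0|v1]; [left|right].
    have /andP[t0 _] := tpt_bounds (ltnW iN).
    case/andP: u01 => u0' _; apply/eqP; rewrite eq_le u0' andbT.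
    rewrite -(ler_pM2r L0) mul0r; move: u0; rewrite sparE => ?; lra.
  have /andP[_ t1] := tpt_bounds iN.
  case/andP: v01 => _ v1'; apply/eqP; rewrite eq_le v1'/=.
  rewrite -(ler_pM2r L0) mul1r; move: v1 t1; rewrite sparE tptS => ? ?; lra.
- have iN : (i < N)%N by exact: ltn_trans jN.
  have j0 : (0 < j)%N by exact: leq_ltn_trans ij.
  have iN1 : (i.+1 < N)%N by exact: leq_ltn_trans jN.
  have su := spar_unit iN u01; have sv := spar_unit jN v01.
  have /andP[_ bu] := spar_bounds i u01; have /andP[bv _] := spar_bounds j v01.
  have [gu gv] := (phi_in u01, phi_in v01).
  apply: far => //; [exact: ltW| |].
    case: uv => uv.
      exists 0%N; first exact: N_gt0.
      have := le_tpt j0; rewrite tptS tpt0 add0r uv sub0r normrN ger0_norm.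
        by move=> /le_trans; apply.
      by case/andP: sv.
    exists N.-1; first exact: last_lt.
    have : tpt r s N = tpt r s N.-1 + r N.-1 `^ s by rewrite -tptS N_pred.
    have : tpt r s i.+1 <= tpt r s N.-1 by apply: le_tpt; rewrite -ltnS N_pred.
    rewrite tptN uv distrC ger0_norm; last by case/andP: su => _ ?; lra.
    by move=> ? ?; lra.
  have [_ Pi] := cP i (phi u) iN gu; have [Pj _] := cP j (phi v) jN gv.
  case: uv => ->; rewrite ?phi_source ?phi_target phi_spar//.
    exact: Pj.
  exact: Pi.
Qed.

(** * The two implications *)

Lemma quasiarc_bi_holder : quasiarc gamma ->
  exists c C, [/\ 0 < c, 0 < C & forall u v,
    0 <= u -> u <= v -> v <= 1 -> holder_at c C u v].
Proof.
move=> qa; have [H H1 turn] := quasiarc_bounded_turning qa.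
have H0 : 0 < H by exact: lt_le_trans H1.
(* If a = b, then [gamma] is a single point and has no injective parameterization. *)
have ab : a <> b.
  move=> /degenerate_invariant_set ga; case: qa => f [fg [finj _]].
  have f_a t : 0 <= t <= 1 -> f t = a by move=> t01; apply: ga; apply: fg; rewrite /= in_itv.
  have := @finj 0 1; rewrite !in_itv/= !lexx ler01 => /(_ isT isT).
  rewrite !f_a ?lexx ?ler01// => /(_ erefl)/eqP.
  by rewrite eq_sym oner_eq0.
have [c1 [C1 [c10 C10 ends]]] := holder_endpoints ab.
have [c2 c20 sep] := piece_separation.
have [m m0 [M M0 far]] := far_bound.
have p2 : 0 < 2 `^ s^-1 :> R by rewrite powR_gt0.
pose c3 := c1 / (H * 2 `^ s^-1).
have c30 : 0 < c3 by rewrite divr_gt0 ?mulr_gt0.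
pose C2 := M / m `^ s^-1; have C20 : 0 < C2 by rewrite divr_gt0 ?powR_gt0.
(* The pair [c2], [C2] serves non-adjacent pieces; [c3] and [C1 + C1] come from joining at a contact
   point. *)
exists (Num.min c2 c3), (C2 + (C1 + C1)); split.
- by rewrite lt_min c20.
- by rewrite !addr_gt0.
apply: scaling_ind => [u _|i u v iN u01 v01|i j u v ij jN u01 v01].
- exact: holder_refl.
- exact: holder_spar.
have iN : (i < N)%N by exact: ltn_trans jN.
have iN1 : (i.+1 < N)%N by exact: leq_ltn_trans jN.
have su := spar_unit iN u01; have sv := spar_unit jN v01.
have /andP[_ bu] := spar_bounds i u01; have /andP[bv _] := spar_bounds j v01.
have [gu gv] := (phi_in u01, phi_in v01).
have [i1j|ji] := boolP (i.+1 < j)%N.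
  apply: (@holder_weaken c2 C2); first by rewrite ge_min lexx.
    by rewrite lerDl !addr_ge0 ?ltW.
  apply: far => //; [exact: ltW| |].
    exists i.+1 => //; have := le_tpt i1j; rewrite tptS.
    by move=> ?; rewrite ler0_norm; have := interval_length_gt0 iN1; lra.
  by rewrite !phi_spar//; exact: sep.
have {ji} ij1 : j = i.+1 by apply/eqP; rewrite eqn_leq ij andbT leqNgt.
rewrite {ij j}ij1 in jN sv bv *.
have p01 : 0 <= (0 : R) <= 1 by rewrite lexx ler01.
have p11 : 0 <= (1 : R) <= 1 by rewrite lexx ler01.
have phit : phi (tpt r s i.+1) = S i.+1 a by rewrite -spar0 phi_spar// phi_source.
apply: (@holder_weaken c3 (C1 + C1)).
- by rewrite ge_min lexx orbT.
- by rewrite lerDr ltW.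
(* The contact point S_{i+1}(a) cuts [gamma] into [A], the pieces up to [i], and [B], the pieces
   from i+1 on. *)
pose A := \bigcup_(k in `I_i.+1) (S k @` gamma).
pose B := \bigcup_(k in [set k | (i < k < N)%N]) (S k @` gamma).
have pieceC k : (k < N)%N -> closed (S k @` gamma).
  by move=> /compact_piece; apply: compact_closed; exact: norm_hausdorff.
have cA : closed A.
  apply: closed_bigcup; first exact: finite_II.
  by move=> k /= ki; apply: pieceC; exact: leq_trans ki iN.
have cB : closed B.
  apply: closed_bigcup; last by move=> k /= /andP[_]; exact: pieceC.
  by apply: (@sub_finite_set _ _ `I_N); [move=> k /= /andP[]|exact: finite_II].
have gAB : gamma = A `|` B.
  apply/seteqP; split=> x.
    move=> /pieceP[k [y [kN gy ->]]]; have [ki|ik] := leqP k i.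
      by left; exists k => //; exists y.
    by right; exists k; rewrite /= ?ik//; exists y.
  case=> [] [k /= kP [y gy <-]]; apply: piece_subset => //.
    exact: leq_trans kP iN.
  by case/andP: kP.
have ABt : A `&` B = [set S i.+1 a].
  apply/seteqP; split=> [x [[k /= ki Skx] [l /= /andP[il lN] Slx]]|_ ->].
    have kN : (k < N)%N by exact: leq_trans ki iN.
    have kl : (S k @` gamma `&` S l @` gamma) x by [].
    have [kl1|kl1] := boolP (k.+1 < l)%N; first by rewrite apart in kl.
    rewrite -leqNgt in kl1; rewrite ltnS in ki.
    have ik : i = k.
      by apply/eqP; rewrite eqn_leq ki andbT -ltnS; exact: leq_trans kl1.
    have lk : l = k.+1 by apply/eqP; rewrite eqn_leq kl1 -ik.
    by rewrite lk -ik touch in kl.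
  have [Si _] : (S i @` gamma `&` S i.+1 @` gamma) (S i.+1 a) by rewrite touch.
  split; first by exists i => /=.
  by exists i.+1 => /=; [rewrite ltnSn|exists a => //; exact: source_in].
have Au : A (phi (spar r s i u)).
  by exists i => //=; rewrite phi_spar//; exists (phi u).
have Bv : B (phi (spar r s i.+1 v)).
  by exists i.+1 => /=; [rewrite ltnSn|rewrite phi_spar//; exists (phi v)].
apply: (@holder_join c1 C1 H _ (tpt r s i.+1)) => //.
- exact: ltW.
- exact: ltW.
- by rewrite bu bv.
- by rewrite phit; apply: (turn A B).
(* Bounded turning seen from the other end, with [A] and [B] exchanged. *)
- rewrite phit eucl_distC (eucl_distC (phi (spar r s i u))).
  by apply: (turn B A) => //; rewrite 1?setUC 1?setIC.
(* The contact parameter is s_i(1) = s_{i+1}(0), so zooming reduces the two halves to the pairs (u,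
   1) and (0, v). *)
- rewrite -spar1; apply: holder_spar => //.
  by case/andP: u01 => u0 u1; apply: ends => //; right.
- rewrite -spar0; apply: holder_spar => //.
  by case/andP: v01 => v0 v1; apply: ends => //; left.
Qed.

Lemma bi_holder_quasiarc K : 1 <= K ->
  (forall u v : R, 0 <= u <= 1 -> 0 <= v <= 1 ->
     K^-1 * `|u - v| `^ s^-1 <= eucl_dist (phi u) (phi v) <= K * `|u - v| `^ s^-1) ->
  quasiarc gamma.
Proof.
move=> K1 bh; have K0 : 0 < K by exact: lt_le_trans K1.
have p0 := exponent_gt0.
have phic : {within `[0, 1], continuous phi}.
  apply: within_continuous_eucl => x; rewrite /= in_itv/= => x01 e e0.
  have eK : 0 <= e / K by rewrite divr_ge0 ?ltW.
  exists ((e / K) `^ s) => [|y]; first by rewrite powR_gt0 ?divr_gt0.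
  rewrite in_itv/= => y01 xy; have /andP[_] := bh x y x01 y01.
  move=> /le_trans; apply; rewrite mulrC -ler_pdivlMr//.
  have -> : e / K = ((e / K) `^ s) `^ s^-1.
    by rewrite -powRrM mulfV ?powRr1// gt_eqF//; case: dim.
  by rewrite ge0_ler_powR ?nnegrE ?powR_ge0// ltW.
exists phi; split; [|split; [|split]].
- by move=> t /=; rewrite in_itv/=; exact: phi_in.
- move=> u v; rewrite !in_itv/= => u01 v01 uv.
  have /andP[+ _] := bh u v u01 v01; rewrite uv eucl_distxx.
  rewrite pmulr_rle0 ?invr_gt0// => h.
  have /eqP : `|u - v| `^ s^-1 = 0 by apply/eqP; rewrite eq_le h powR_ge0.
  by rewrite powR_eq0 (gt_eqF p0) andbT normr_eq0 subr_eq0 => /eqP.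
(* For surjectivity, the image of [phi] is compact and mapped into itself by each S_i, so it
   contains the self-similar set [gamma]. *)
- apply/seteqP; split.
    by move=> _ [t /= t01 <-]; apply: phi_in; rewrite in_itv in t01.
  have [_ [cg _]] := inv; have [M M0 gM] := compact_eucl_bounded cg.
  apply: (@subset_of_self_similar _ _ M) => //.
  + exact: pieceP.
  + move=> i _ iN [t /= t01 <-]; rewrite in_itv/= in t01.
    exists (spar r s i t); last exact: phi_spar.
    by rewrite /= in_itv/=; exact: spar_unit.
  + move=> x _ gx [t /= t01 <-]; apply: gM => //; apply: phi_in.
    by rewrite in_itv in t01.
  + by exists (phi 0), 0 => //=; rewrite in_itv/= lexx ler01.
  + apply: compact_closed; first exact: norm_hausdorff.
    by apply: continuous_compact => //; exact: segment_compact.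
- exists (fun t => K ^+ 2 * t `^ s^-1); split.
    by apply: powR_homeo_nonneg => //; rewrite exprn_gt0.
  move=> x y z t; rewrite !in_itv/= => x01 y01 z01 t0 xyz.
  have /andP[_ xy] := bh x y x01 y01; have /andP[xz _] := bh x z x01 z01.
  (* One factor [K] comes from the upper bound at (x, y), the other from the lower bound at (x,
     z). *)
  apply: (le_trans xy); rewrite expr2 -!mulrA ler_pM2l//.
  rewrite mulrCA (@le_trans _ _ (t `^ s^-1 * `|x - z| `^ s^-1))//.
    by rewrite -powRM// ge0_ler_powR ?nnegrE ?mulr_ge0// ltW.
  by rewrite ler_wpM2l ?powR_ge0// -ler_pdivrMl.
Qed.

Lemma quasiarc_iff_bi_holder : quasiarc gamma <->
  exists K : R, 1 <= K /\ forall u v : R, 0 <= u <= 1 -> 0 <= v <= 1 ->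
    K^-1 * `|u - v| `^ s^-1 <= eucl_dist (phi u) (phi v) <= K * `|u - v| `^ s^-1.
Proof.
split=> [/quasiarc_bi_holder|[K [K1 bh]]]; last exact: bi_holder_quasiarc bh.
(* This [K] is at least 1, 1/c and [C] at once. *)
move=> [c [C [c0 C0 bh]]]; exists (1 + (c^-1 + C)).
have cV0 : 0 < c^-1 by rewrite invr_gt0.
split=> [|u v u01 v01]; first by rewrite lerDl addr_ge0 ?ltW.
suff : holder_at (1 + (c^-1 + C))^-1 (1 + (c^-1 + C)) u v by [].
apply: (@holder_weaken c C).
- rewrite -[leRHS]invrK lef_pV2 ?posrE ?addr_gt0//; lra.
- lra.
case/andP: u01 => u0 u1; case/andP: v01 => v0 v1.
by have [uv|/ltW vu] := leP u v; [|apply: holder_sym]; exact: bh.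
Qed.

End HutchinsonParameterization.

Unset Implicit Arguments.
Set Strict Implicit.

Theorem theorem1p5 (R : realType) (n N : nat) (S : nat -> 'rV[R]_n -> 'rV[R]_n)
    (r : nat -> R) (gamma : set 'rV[R]_n) (a b : 'rV[R]_n) (s : R) (phi : R -> 'rV[R]_n) :
  contracting_IFS N S r ->
  invariant_set N S gamma ->
  IFS_arc N S gamma a b ->
  similarity_dimension N r s ->
  hutchinson_param N S r s a b phi ->
  (quasiarc gamma <->
   exists K : R, 1 <= K /\
     forall u v : R, 0 <= u <= 1 -> 0 <= v <= 1 ->
       K^-1 * `|u - v| `^ s^-1 <= eucl_dist (phi u) (phi v) <= K * `|u - v| `^ s^-1).
Proof.
move=> ifs inv [path [touch apart]] dim hut.
exact: (quasiarc_iff_bi_holder ifs inv path dim hut touch apart).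
Qed.
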